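(* Let $p\in\mathbb{R}[x_1,x_2]$ be an irreducible polynomial of degree $m\ge 1$ defining a plane curve $\mathcal{C}=\{x\in\mathbb{R}^2: p(x)=0\}$ of genus zero, and let $q_0,q_1,q_2\in\mathbb{R}[u]$ be univariate polynomials of degree $m$ giving a rational parametrization $x_1=q_1(u)/q_0(u)$, $x_2=q_2(u)/q_0(u)$ of $\mathcal{C}$. Define $$F(x)=B(q_1,q_2)+x_1B(q_2,q_0)+x_2B(q_0,q_1)=F_0+x_1F_1+x_2F_2,$$ where $B(\cdot,\cdot)$ denotes the $m\times m$ Bézoutian matrix. Then $F(x)$ is a symmetric linear pencil of size $m$, and $\det F(x)$ is an implicit defining polynomial of the curve $\mathcal{C}$, i.e. $\det F(x)$ equals $p(x)$ up to a nonzero constant factor.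
   Context: Bézoutian: given two univariate polynomials $g,h$, both regarded as polynomials of degree $m$ (a polynomial of smaller degree is regarded as a degree $m$ polynomial with zero leading coefficients), write $$\frac{g(u)h(v)-g(v)h(u)}{u-v}=\sum_{k=0}^{m-1}\sum_{l=0}^{m-1}b_{kl}u^kv^l .$$ The Bézoutian matrix $B(g,h)$ is the symmetric $m\times m$ matrix with entries $b_{kl}$, $0\le k,l\le m-1$. Rational parametrization: $q_0,q_1,q_2\in\mathbb{R}[u]$ (each regarded as having degree $m$, where a polynomial of smaller degree is regarded as a degree $m$ polynomial with zero leading coefficients) have no common factor, $q_0\neq 0$, the map $u\mapsto (q_1(u)/q_0(u),q_2(u)/q_0(u))$ is not constant, $p(q_1(u)/q_0(u),q_2(u)/q_0(u))=0$ identically in $u$, and the points of $\mathcal{C}$ are, up to finitely many, those of the form $(q_1(u)/q_0(u),q_2(u)/q_0(u))$ with $u\in\mathbb{R}$. *)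

(* Defs.v *)
From mathcomp Require Import all_boot all_order all_algebra.
From mathcomp Require Import reals.
From mathcomp Require Import mpoly.

Set Implicit Arguments.
Unset Strict Implicit.
Unset Printing Implicit Defensive.

Import GRing.Theory.
Local Open Scope ring_scope.

(* In {poly {poly R}} the outer variable is u and the inner one is v, so that
   g(u) is g^:P, g(v) is g%:P, and u - v is 'X - 'X%:P. *)
Definition bezout_num (R : idomainType) (g h : {poly R}) : {poly {poly R}} :=
  g^:P * h%:P - g%:P * h^:P.

Definition bezoutian (R : idomainType) (m : nat) (g h : {poly R}) : 'M[R]_m :=
  \matrix_(k, l) (bezout_num g h %/ ('X - 'X%:P))`_k`_l.

(* The division above is exact, and no coefficient is truncated. *)
Lemma bezoutianP (R : idomainType) (m : nat) (g h : {poly R}) :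
  (size g <= m.+1)%N -> (size h <= m.+1)%N ->
  bezout_num g h =
    ('X - 'X%:P) *
      \sum_(k < m) \sum_(l < m) (bezoutian m g h k l)%:P%:P * 'X^k * 'X^l%:P.
Proof.
move=> sg sh; rewrite /bezoutian; set N := bezout_num g h.
have NX : root N 'X.
  by rewrite rootE /N /bezout_num !hornerE -!/(comp_poly _ _) !comp_polyXr subrr.
case/factor_theorem: NX => Q NE.
have -> : N %/ ('X - 'X%:P) = Q.
  by rewrite NE Pdiv.IdomainMonic.mulpK // monicXsubC.
have sN : (size N <= m.+1)%N.
  rewrite /N /bezout_num (leq_trans (size_polyD _ _)) // size_polyN geq_max.
  apply/andP; split; rewrite ?[_%:P * _]mulrC.
    apply: leq_trans (size_polyMleq _ _) _.
    apply: leq_trans (_ : ((size g).+1).-1 <= _)%N => //.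
    rewrite (size_map_inj_poly (@polyC_inj R)) // -[(size g).+1]addn1.
    by rewrite -!subn1 leq_sub2r // leq_add2l size_polyC leq_b1.
  apply: leq_trans (size_polyMleq _ _) _.
  apply: leq_trans (_ : ((size h).+1).-1 <= _)%N => //.
  rewrite (size_map_inj_poly (@polyC_inj R)) // -[(size h).+1]addn1.
  by rewrite -!subn1 leq_sub2r // leq_add2l size_polyC leq_b1.
have sQ : (size Q <= m)%N.
  have [->|Q0] := eqVneq Q 0; first by rewrite size_poly0.
  have := sN; rewrite NE size_Mmonic ?monicXsubC // size_XsubC addn2 /=.
  by rewrite ltnS.
have symQ : swapXY Q = Q.
  apply: (@mulIf _ ('X - 'X%:P)); first by rewrite polyXsubC_eq0.
  rewrite -NE; apply: oppr_inj; rewrite -mulrN opprB.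
  have -> : 'X%:P - 'X = swapXY ('X - 'X%:P) :> {poly {poly R}}.
    by rewrite raddfB /= swapXY_X swapXY_Y.
  rewrite -rmorphM /= -NE /N /bezout_num raddfB /= !rmorphM /=.
  by rewrite !swapXY_polyC !swapXY_map_polyC opprB.
rewrite NE mulrC; congr (_ * _).
apply/polyP => i; apply/polyP => j; rewrite !coef_sum.
have coefT (k l : 'I_m) : (((\matrix_(k, l) Q`_k`_l) k l)%:P%:P * 'X^k * 'X^l%:P
   : {poly {poly R}})`_i`_j = Q`_k`_l *+ ((i == k) && (j == l)).
  rewrite mxE -mulrA mulrCA mulrC -polyCM coefCM coefXn mulr_natr coefMn.
  by rewrite coefCM coefXn mulr_natr -mulrnA mulnb andbC.
under eq_bigr do rewrite !coef_sum.
under eq_bigr do under eq_bigr do rewrite coefT.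
have [im|mi] := ltnP i m; last first.
  rewrite (nth_default _ (leq_trans sQ mi)) coef0.
  rewrite big1 // => k _; rewrite big1 // => l _.
  by case: eqP => // ik; have := ltn_ord k; rewrite -ik ltnNge mi.
have [jm|mj] := ltnP j m; last first.
  rewrite -[in LHS]symQ coef_swapXY (nth_default _ (leq_trans sQ mj)) coef0.
  rewrite big1 // => k _; rewrite big1 // => l _.
  by rewrite andbC; case: eqP => // jl; have := ltn_ord l; rewrite -jl ltnNge mj.
rewrite (bigD1 (Ordinal im)) //= (bigD1 (Ordinal jm)) //= !eqxx.
rewrite big1 ?addr0; last first.
  by move=> l; rewrite -val_eqE /= eq_sym => /negbTE->.
rewrite big1 ?addr0 // => k; rewrite -val_eqE /= eq_sym => /negbTE->.
by rewrite big1.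
Qed.

Definition linear_pencil (R : comNzRingType) (m : nat) (A0 A1 A2 : 'M[R]_m) :
    'M[{mpoly R[2]}]_m :=
  map_mx (@mpolyC 2 R) A0 + 'X_ord0 *: map_mx (@mpolyC 2 R) A1
    + 'X_ord_max *: map_mx (@mpolyC 2 R) A2.

Definition is_symmetric_linear_pencil (R : comNzRingType) (m : nat)
    (F : 'M[{mpoly R[2]}]_m) : Prop :=
  exists A0 A1 A2 : 'M[R]_m,
    [/\ A0^T = A0, A1^T = A1, A2^T = A2 & F = linear_pencil A0 A1 A2].

Definition irreducible_elt (A : comUnitRingType) (a : A) : Prop :=
  [/\ a != 0, a \isn't a GRing.unit
    & forall b c : A, a = b * c -> b \is a GRing.unit \/ c \is a GRing.unit].

(* K is the fraction field of k[x_1, x_2] / (p), with x the images of the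
   coordinates. *)
Definition is_function_field (k : fieldType) (p : {mpoly k[2]}) (K : fieldType)
    (iota : {rmorphism k -> K}) (x : 'I_2 -> K) : Prop :=
  (forall f : {mpoly k[2]}, mmap iota x f = 0 <-> exists g, f = g * p) /\
  (forall z : K, exists f g : {mpoly k[2]},
     mmap iota x g != 0 /\ z = mmap iota x f / mmap iota x g).

Section Genus.
Variables (k K : fieldType) (iota : {rmorphism k -> K}).

(* For k-subspaces W \subset V of K: dim_k (V / W) = n. *)
Definition quotient_dim (V W : K -> Prop) (n : nat) : Prop :=
  exists b : 'I_n -> K, (forall i, V (b i)) /\
    (forall z, V z ->
       exists! c : {ffun 'I_n -> k}, W (z - \sum_(i < n) iota (c i) * b i)).

(* v(z) >= n, with v(0) = +oo. *)
Definition val_ge (v : K -> int) (n : int) (z : K) : Prop :=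
  z = 0 \/ n <= v z.

(* Places of K / k, as normalized discrete valuations that are trivial on k;
   v 0 is a junk value, fixed so that a place is a single function. *)
Record is_place (v : K -> int) : Prop := IsPlace {
  place_0 : v 0 = 0;
  place_const : forall c : k, v (iota c) = 0;
  place_mul : forall y z : K, y != 0 -> z != 0 -> v (y * z) = v y + v z;
  place_add : forall (n : int) (y z : K),
    val_ge v n y -> val_ge v n z -> val_ge v n (y + z);
  place_unif : exists t : K, t != 0 /\ v t = 1
}.

(* Degree of the residue field over k. *)
Definition place_degree (v : K -> int) (d : nat) : Prop :=
  quotient_dim (val_ge v 0) (val_ge v 1) d.

(* The divisor \sum_i (div_mult i) (div_place i). *)
Record divisor : Type := Divisor {
  div_size : nat;
  div_place : 'I_div_size -> K -> int;
  div_mult : 'I_div_size -> int;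
  div_placeP : forall i, is_place (div_place i);
  div_inj : forall i j, div_place i =1 div_place j -> i = j
}.

Definition divisor_degree (D : divisor) (n : int) : Prop :=
  exists d : 'I_(div_size D) -> nat,
    (forall i, place_degree (div_place i) (d i)) /\
    n = \sum_i div_mult i * (d i)%:Z.

(* L(D) = {z | (z) + D >= 0} together with 0. *)
Definition riemann_roch_space (D : divisor) (z : K) : Prop :=
  (forall i, val_ge (@div_place D i) (- div_mult i) z) /\
  (forall v, is_place v -> (forall i, ~ v =1 @div_place D i) -> val_ge v 0 z).

(* g = max_D (deg D + 1 - dim L(D)). *)
Definition is_genus (g : int) : Prop :=
  (forall (D : divisor) (n : int) (l : nat),
     divisor_degree D n ->
     quotient_dim (riemann_roch_space D) (fun z => z = 0) l ->
     n + 1 - l%:Z <= g) /\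
  (exists (D : divisor) (n : int) (l : nat),
     [/\ divisor_degree D n,
         quotient_dim (riemann_roch_space D) (fun z => z = 0) l
       & n + 1 - l%:Z = g]).

End Genus.

(* Computed over k: this is the genus over the algebraic closure provided that
   the curve is geometrically irreducible (and k is perfect). *)
Definition curve_genus (k : fieldType) (p : {mpoly k[2]}) (g : int) : Prop :=
  exists (K : fieldType) (iota : {rmorphism k -> K}) (x : 'I_2 -> K),
    is_function_field p iota x /\ is_genus iota g.

Definition on_curve (R : realType) (p : {mpoly R[2]}) (x : 'rV[R]_2) : Prop :=
  p.@[x 0] = 0.

(* Meaningful only where q0.[u] != 0. *)
Definition param_point (R : realType) (q0 q1 q2 : {poly R}) (u : R) : 'rV[R]_2 :=
  \row_(i < 2) ((if i == ord0 then q1 else q2).[u] / q0.[u]).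

Record is_rational_parametrization (R : realType) (p : {mpoly R[2]}) (m : nat)
    (q0 q1 q2 : {poly R}) : Prop := IsRationalParametrization {
  (* Degree m is meant formally: leading coefficients may vanish. *)
  param_size0 : (size q0 <= m.+1)%N;
  param_size1 : (size q1 <= m.+1)%N;
  param_size2 : (size q2 <= m.+1)%N;
  param_coprime : forall d : {poly R},
    d %| q0 -> d %| q1 -> d %| q2 -> size d = 1%N;
  param_neq0 : q0 != 0;
  param_nonconst : ~ exists a : 'rV[R]_2,
    forall u, q0.[u] != 0 -> param_point q0 q1 q2 u = a;
  param_on_curve : forall u, q0.[u] != 0 -> on_curve p (param_point q0 q1 q2 u);
  param_cofinite : exists s : seq 'rV[R]_2, forall x, x \notin s ->
    (on_curve p x <-> exists u, q0.[u] != 0 /\ x = param_point q0 q1 q2 u)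
}.

(* Main.v *)
Require Import Defs.
From mathcomp Require Import all_boot all_order all_algebra.
From mathcomp Require Import boolp reals.
From mathcomp Require Import mpoly.
From mathcomp Require Import ring zify.

Set Implicit Arguments.
Unset Strict Implicit.
Unset Printing Implicit Defensive.

Import GRing.Theory Num.Theory.
Local Open Scope ring_scope.

(** By bilinearity and antisymmetry of the Bezoutian, at a point (s, t) the
    pencil takes the value F(s, t) = B(q1 - s q0, q2 - t q0)
    ([bezoutian_pencil]).  At a point of the curve with parameter u both
    arguments vanish at u, and a common root u of g and h puts the vector
    (1, u, u^2, ...) in the kernel of B(g, h) ([det_bezoutian_common_root]).
    So det F vanishes along the parametrization.

    Conversely B(g, h) is invertible when g and h are coprime and one of them
    attains the formal degree ([det_bezoutian_neq0]).  For suitable s and t this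
    holds for q1 - s q0 and q2 - t q0, because the q's have no common factor, so
    det F is not the zero polynomial if the formal degree is the true one
    ([det_bezout_pencil_neq0]).

    A polynomial that vanishes along the parametrization is a multiple of p
    ([vanishing_on_parametrization]).  This is where the function field comes
    in: p generates the kernel of an evaluation in a field, hence is prime, and
    if p does not divide f, then for each coordinate X_i elimination gives a nonzero
    univariate r with r(X_i) in the ideal (p, f).  Then r vanishes at all values
    of the i-th coordinate along the parametrization, which must be constant;
    as this happens for both coordinates, the parametrization is constant.

    The degrees close the argument.  With n the maximal degree of the q's, the
    n x n pencil has a nonzero determinant of degree at most n <= m that is a
    multiple of p, whose degree is m.  Hence n = m and the cofactor is constant.
    The equality n = m says that the parametrization has neither a superfluous
    formal degree nor a covering degree above 1. *)

(** * Bezoutian matrices *)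

(** The k-th row of the Bezoutian as a polynomial; the closed form solves the
    recursion beta_(k-1) = v beta_k + g_k h - h_k g that comes from comparing
    the coefficients of u^k in the definition of the Bezoutian. *)
Definition bezout_row (R : idomainType) (g h : {poly R}) (k : nat) : {poly R} :=
  drop_poly k.+1 g * h - drop_poly k.+1 h * g.

Lemma drop_poly_cons (R : nzSemiRingType) k (g : {poly R}) :
  drop_poly k g = (g`_k)%:P + drop_poly k.+1 g * 'X.
Proof.
apply/polyP => -[|i]; rewrite coefD coefMX !coef_drop_poly coefC /=.
  by rewrite addr0 add0n.
by rewrite add0r addSnnS.
Qed.

Lemma bezout_quotient_coef (R : idomainType) (g h : {poly R}) k :
  (bezout_num g h %/ ('X - 'X%:P))`_k = bezout_row g h k.
Proof.
pose n := maxn (size g) (size h).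
have row0 i : (n <= i)%N -> bezout_row g h i = 0.
  rewrite geq_max => /andP[gi hi].
  by rewrite /bezout_row !drop_poly_eq0 ?mul0r ?subrr // leqW.
have [Q QE] : exists Q : {poly {poly R}}, forall i, Q`_i = bezout_row g h i.
  exists (\poly_(i < n) bezout_row g h i) => i.
  by rewrite coef_poly; case: ltnP => // /row0.
suff -> : bezout_num g h = Q * ('X - 'X%:P).
  by rewrite Pdiv.IdomainMonic.mulpK ?monicXsubC // QE.
apply/polyP => i; rewrite /bezout_num mulrBr.
rewrite !(coefB, coefMC, coefCM, coefMX, coef_map) /= !QE /bezout_row.
have dropE := @drop_poly_cons R i.
case: i dropE => [|i] dropE /=.
  have low (f : {poly R}) : (f`_0)%:P = f - drop_poly 1 f * 'X.
    by have := dropE f; rewrite drop_poly0l => {2}->; rewrite addrK.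
  by rewrite !low; ring.
by rewrite (dropE g) (dropE h); ring.
Qed.

Lemma bezoutianE (R : idomainType) m (g h : {poly R}) k l :
  bezoutian m g h k l = (bezout_row g h k)`_l.
Proof. by rewrite mxE bezout_quotient_coef. Qed.

(** The closed form of the row suggests a degree up to 2m; it is the low-order
    parts of g and h that bound it, since X^(k+1) times the row equals
    take(h) g - take(g) h, both sides differing from g h - h g = 0 by the same
    terms. *)
Lemma size_bezout_row (R : idomainType) m (g h : {poly R}) k :
  (size g <= m.+1)%N -> (size h <= m.+1)%N -> (size (bezout_row g h k) <= m)%N.
Proof.
move=> sg sh; have [->|row0] := eqVneq (bezout_row g h k) 0.
  by rewrite size_poly0.
rewrite -(leq_add2l k.+1) -size_mulXn //.
have -> : bezout_row g h k * 'X^(k.+1) =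
    take_poly k.+1 h * g - take_poly k.+1 g * h.
  have low (f : {poly R}) : take_poly k.+1 f = f - drop_poly k.+1 f * 'X^(k.+1).
    by rewrite -{2}[f](poly_take_drop k.+1) addrK.
  by rewrite !low /bezout_row; ring.
have bound (a b : {poly R}) :
    (size b <= m.+1)%N -> (size (take_poly k.+1 a * b)%R <= k.+1 + m)%N.
  move=> sb; apply: leq_trans (size_polyMleq _ _) _.
  have := leq_add (size_take_poly k.+1 a) sb.
  by rewrite [(_ + m.+1)%N]addnS; case: (_ + _)%N.
by rewrite (leq_trans (size_polyD _ _)) // size_polyN geq_max !bound.
Qed.

(** Exchanging u and v changes the sign of both the numerator and of u - v. *)
Lemma bezoutian_sym (R : idomainType) m (g h : {poly R}) :
  (bezoutian m g h)^T = bezoutian m g h.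
Proof.
apply/matrixP => k l; rewrite !mxE.
set N := bezout_num g h; have NX : root N 'X.
  by rewrite rootE /N /bezout_num !hornerE -!/(comp_poly _ _) !comp_polyXr subrr.
case/factor_theorem: NX => Q NE.
rewrite NE Pdiv.IdomainMonic.mulpK ?monicXsubC //.
suff symQ : swapXY Q = Q by rewrite -[in LHS]symQ coef_swapXY.
apply: (@mulIf _ ('X - 'X%:P)); first by rewrite polyXsubC_eq0.
rewrite -NE; apply: oppr_inj; rewrite -mulrN opprB.
have -> : 'X%:P - 'X = swapXY ('X - 'X%:P) :> {poly {poly R}}.
  by rewrite raddfB /= swapXY_X swapXY_Y.
rewrite -rmorphM /= -NE /N /bezout_num raddfB /= !rmorphM /=.
by rewrite !swapXY_polyC !swapXY_map_polyC opprB.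
Qed.

Lemma bezoutian_pencil (R : idomainType) m (q0 q1 q2 : {poly R}) (s t : R) :
  bezoutian m q1 q2 + s *: bezoutian m q2 q0 + t *: bezoutian m q0 q1
  = bezoutian m (q1 - s *: q0) (q2 - t *: q0).
Proof.
apply/matrixP => k l; rewrite !mxE !bezout_quotient_coef -!coefZ -!coefD.
apply: (congr1 (fun f : {poly R} => f`_l)); rewrite /bezout_row.
by rewrite !raddfB /= !drop_polyZ -!mul_polyC; ring.
Qed.

Lemma det_bezoutian_common_root (R : idomainType) m (g h : {poly R}) u :
  (0 < m)%N -> (size g <= m.+1)%N -> (size h <= m.+1)%N ->
  root g u -> root h u -> \det (bezoutian m g h) = 0.
Proof.
case: m => // m _ sg sh /rootP gu /rootP hu.
rewrite -det_tr bezoutian_sym; apply/eqP/det0P.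
exists (\row_k u ^+ k).
  apply/eqP => /matrixP/(_ 0 0); rewrite !mxE expr0; exact/eqP/oner_neq0.
rewrite -[bezoutian _ _ _]bezoutian_sym.
apply/matrixP => i k; rewrite !mxE.
transitivity (bezout_row g h k).[u].
  rewrite (horner_coef_wide _ (size_bezout_row k sg sh)).
  by apply: eq_bigr => l _; rewrite !mxE bezout_quotient_coef mulrC.
by rewrite !hornerE gu hu !mulr0 subrr.
Qed.

(** Modulo g, the k-th row is h times w_k := drop_poly k.+1 g.  A linear
    relation between the rows thus says that g divides h w for the
    corresponding combination w of the w_k, hence divides w, whose degree is
    below m; so w = 0.  As w_k has degree exactly m - 1 - k, the relation is
    trivial. *)
Lemma det_bezoutian_neq0 (F : fieldType) m (g h : {poly F}) :
  size g = m.+1 -> (size h <= m.+1)%N -> coprimep g h ->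
  \det (bezoutian m g h) != 0.
Proof.
move=> sg sh gh; apply/negP => /det0P[c c0 cB].
pose w := \sum_(k < m) c 0 k *: drop_poly k.+1 g.
have sw : (size w <= m)%N.
  apply: leq_trans (size_sum _ _ _) _; apply/bigmax_leqP => k _.
  apply: leq_trans (size_scale_leq _ _) _.
  by rewrite size_drop_poly sg subSS leq_subr.
have whE : w * h = (\sum_(k < m) c 0 k *: drop_poly k.+1 h) * g.
  apply/eqP; rewrite -subr_eq0; apply/eqP.
  transitivity (\sum_(k < m) c 0 k *: bezout_row g h k).
    rewrite !mulr_suml -sumrB; apply: eq_bigr => k _.
    by rewrite -!scalerAl -scalerBr.
  have ssg : (size g <= m.+1)%N by rewrite sg.
  apply/polyP => l; rewrite coef_sum coef0.
  have [lm|ml] := ltnP l m; last first.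
    rewrite big1 // => k _; rewrite coefZ nth_default ?mulr0 //.
    exact: leq_trans (size_bezout_row _ ssg sh) ml.
  have := congr1 (fun M : 'rV_m => M 0 (Ordinal lm)) cB; rewrite !mxE.
  by apply: etrans; apply: eq_bigr => k _; rewrite coefZ bezoutianE.
have w0 : w = 0.
  apply/eqP; apply: contraTT sw => w0; rewrite -ltnNge -sg.
  apply: dvdp_leq => //; rewrite -(Gauss_dvdpl _ gh) whE.
  exact: dvdp_mulIr.
case/negP: c0; apply/eqP/rowP => i; rewrite mxE.
(* The coefficient of degree m - 1 - i of w involves only the c k with k <= i:
   those with k < i are 0 by induction. *)
have [n nm] := ubnP (val i); elim: n i nm => // n IH i; rewrite ltnS => im.
have := congr1 (fun p : {poly F} => p`_(m.-1 - i)) w0.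
rewrite coef0 coef_sum (bigD1 i) //= big1 ?addr0.
  rewrite coefZ coef_drop_poly.
  have -> : (m.-1 - i + i.+1 = m)%N.
    by have := ltn_ord i; lia.
  have : lead_coef g != 0 by rewrite lead_coef_eq0 -size_poly_eq0 sg.
  rewrite lead_coefE sg /= => gm /eqP; rewrite mulf_eq0 (negPf gm) orbF.
  by move/eqP.
move=> k; rewrite neq_ltn => /orP[ki|ik].
  by rewrite (IH k) ?scale0r ?coef0 // (leq_trans ki).
rewrite coefZ coef_drop_poly nth_default ?mulr0 // sg.
by move: ik (ltn_ord i) => /=; lia.
Qed.

(** * Univariate polynomials along a rational map *)

Lemma poly_non_root (F : numFieldType) (f : {poly F}) :
  f != 0 -> exists u, f.[u] != 0.
Proof.
move=> f0; have /hasP[u _ fu] : has (fun u => ~~ root f u)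
    [seq i%:R | i <- iota 0 (size f)].
  rewrite has_predC; apply/negP => /(max_poly_roots f0).
  rewrite map_inj_uniq ?iota_uniq; last first.
    by move=> i j /eqP; rewrite eqr_nat => /eqP.
  by rewrite size_map size_iota ltnn => /(_ isT).
by exists u.
Qed.

(** The polynomial w carries the finitely many parameters that the induction on
    the degree of r has to leave out: at some parameter r has the root c, and if
    q - c q0 is not 0, then away from its roots the other factor of r still
    vanishes. *)
Lemma algebraic_ratio_constant (F : numFieldType) (q0 q w r : {poly F}) :
  q0 != 0 -> w != 0 -> r != 0 ->
  (forall u, w.[u] != 0 -> q0.[u] != 0 -> r.[q.[u] / q0.[u]] = 0) ->
  exists c, q = c *: q0.
Proof.
move=> q00; have [n] := ubnP (size r); elim: n r w => // n IH r w rn w0 r0 rv.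
have [u] := poly_non_root (mulf_neq0 w0 q00).
rewrite hornerM mulf_eq0 negb_or => /andP[wu q0u].
set c := q.[u] / q0.[u]; have /factor_theorem[r' rE] : root r c.
  by rewrite rootE rv.
have [qE|qcq0] := eqVneq (q - c *: q0) 0.
  by exists c; apply/eqP; rewrite -subr_eq0 qE.
have r'0 : r' != 0 by apply: contraNneq r0 => r'0; rewrite rE r'0 mul0r.
apply: (IH r' (w * (q - c *: q0))); rewrite ?mulf_neq0 //.
  by move: rn; rewrite rE size_Mmonic ?monicXsubC // size_XsubC addn2.
move=> v; rewrite hornerM mulf_eq0 negb_or => /andP[wv qv] q0v.
have /eqP := rv v wv q0v; rewrite rE hornerM mulf_eq0 => /orP[/eqP //|].
rewrite hornerXsubC subr_eq0 => /eqP qc; case/negP: qv.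
by rewrite !hornerE -qc divfK // subrr.
Qed.

(** For distinct t, a common divisor of a, b - t c and b - t' c divides a, b and
    c, so the gcds of a with the b - t c are pairwise coprime divisors of a, and
    fewer than size a of them can be nonconstant. *)
Lemma exists_coprime_combination (F : numFieldType) (a b c : {poly F}) :
  a != 0 ->
  (forall d, d %| a -> d %| b -> d %| c -> size d = 1%N) ->
  exists t, coprimep a (b - t *: c).
Proof.
move=> a0 abc.
have [/existsP[i]|] :=
  boolP [exists i : 'I_(size a), coprimep a (b - (i : nat)%:R *: c)].
  by exists (i : nat)%:R.
rewrite negb_exists => /forallP noncop.
pose d i := gcdp a (b - i%:R *: c).
have size_d i : (i < size a)%N -> (1 < size (d i))%N.
  move=> ia; have := noncop (Ordinal ia); rewrite /coprimep /= -/(d i).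
  have : d i != 0 by rewrite gcdp_eq0 negb_and a0.
  by rewrite -size_poly_gt0; case: (size (d i)) => [|[]].
have cop_d i j : i != j -> coprimep (d i) (d j).
  move=> ij; apply/coprimepP => e ei ej; rewrite -size_poly_eq1.
  have [ea eb] : e %| a /\ e %| b - i%:R *: c by apply/andP; rewrite -dvdp_gcd.
  have [_ eb'] : e %| a /\ e %| b - j%:R *: c by apply/andP; rewrite -dvdp_gcd.
  have ec : e %| c.
    have nij : (j%:R - i%:R : F) != 0 by rewrite subr_eq0 eqr_nat eq_sym.
    rewrite -(dvdpZr e c nij).
    have -> : (j%:R - i%:R) *: c = (b - i%:R *: c) - (b - j%:R *: c).
      by rewrite scalerBl opprB [RHS]addrC addrA subrK addrC.
    by rewrite dvdp_sub.
  apply/eqP/(abc e ea _ ec).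
  by rewrite -[b](subrK (i%:R *: c)) dvdp_add // -mul_polyC dvdp_mull.
have prodP n : (n <= size a)%N ->
    \prod_(i < n) d i %| a /\ (n < size (\prod_(i < n) d i)%R)%N.
  elim: n => [_|n IH na]; first by rewrite big_ord0 dvd1p size_poly1.
  have [div sz] := IH (ltnW na); rewrite big_ord_recr /=; split.
    rewrite Gauss_dvdp ?div ?dvdp_gcdl //.
    have : forall i : 'I_n, coprimep (d i) (d n).
      by move=> i; apply: cop_d; rewrite neq_ltn ltn_ord.
    by move=> cop; elim/big_ind: _ => //= [|x y xn yn];
      rewrite ?coprime1p // coprimepMl xn yn.
  rewrite size_mul -?size_poly_gt0; last 2 first.
  - exact: leq_ltn_trans sz.
  - exact: ltnW (size_d _ na).
  move: (size_d _ na) sz; set s1 := size (d n); set s2 := size _; lia.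
have [/(dvdp_leq a0) + sz] := prodP _ (leqnn _).
by rewrite leqNgt sz.
Qed.

(** * Elimination in two variables *)

Definition mdvd (k : fieldType) (p f : {mpoly k[2]}) : Prop :=
  exists g, f = g * p.

Section Elimination.
Variables (k : fieldType) (i j : 'I_2).

Definition poly_in : {rmorphism {poly k} -> {mpoly k[2]}} :=
  horner_eval 'X_i \o map_poly (@mpolyC 2 k).

(** Two variables as one variable over the other: the inner variable of
    {poly {poly k}} is X_i, to be kept, and the outer one is X_j, to be
    eliminated. *)
Definition of_biv : {rmorphism {poly {poly k}} -> {mpoly k[2]}} :=
  horner_eval 'X_j \o map_poly poly_in.

Definition to_biv : {rmorphism {mpoly k[2]} -> {poly {poly k}}} :=
  mmap (polyC \o polyC) (fun l => if l == i then 'X%:P else 'X).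

Lemma poly_inC c : poly_in c%:P = c%:MP.
Proof. by rewrite /poly_in /= map_polyC /= /horner_eval hornerC. Qed.

Lemma poly_inX : poly_in 'X = 'X_i.
Proof. by rewrite /poly_in /= map_polyX /= /horner_eval hornerX. Qed.

Lemma of_bivC r : of_biv r%:P = poly_in r.
Proof. by rewrite /of_biv /= map_polyC /= /horner_eval hornerC. Qed.

Lemma of_bivX : of_biv 'X = 'X_j.
Proof. by rewrite /of_biv /= map_polyX /= /horner_eval hornerX. Qed.

Lemma meval_poly_in (v : 'I_2 -> k) r : (poly_in r).@[v] = r.[v i].
Proof.
elim/poly_ind: r => [|r c IH]; first by rewrite rmorph0 meval0 horner0.
rewrite rmorphD rmorphM poly_inC poly_inX mevalD mevalM mevalC mevalXU IH.
by rewrite !hornerE.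
Qed.

Hypothesis ij : i != j.

Lemma to_bivK : cancel to_biv of_biv.
Proof.
have X_l l : of_biv (if l == i then 'X%:P else 'X) = 'X_l.
  have [->|li] := eqVneq l i; first by rewrite of_bivC poly_inX.
  rewrite of_bivX; congr 'X_ _; apply: val_inj.
  move: ij li; rewrite -!val_eqE.
  by case: i j l => [[|[]] //= _] [[|[]] //= _] [[|[]] //= _].
elim/mpolyind => [|c m f _ _ IH]; first by rewrite !rmorph0.
rewrite !rmorphD IH; congr (_ + _).
rewrite [to_biv _]mmapZ mmapX rmorphM of_bivC poly_inC mul_mpolyC /mmap1.
rewrite rmorph_prod mpolyXE_id; congr (_ *: _); apply: eq_bigr => l _.
by rewrite rmorphXn X_l.
Qed.

Lemma to_biv_poly_in r : to_biv (poly_in r) = r%:P.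
Proof.
elim/poly_ind: r => [|r c IH]; first by rewrite !rmorph0.
rewrite rmorphD rmorphM poly_inC poly_inX rmorphD rmorphM IH.
rewrite [to_biv _%:MP]mmapC [to_biv _]mmapX mmap1U eqxx.
by rewrite -polyCM -polyCD.
Qed.

Lemma of_bivK : cancel of_biv to_biv.
Proof.
elim/poly_ind => [|f c IH]; first by rewrite !rmorph0.
rewrite rmorphD rmorphM of_bivC of_bivX rmorphD rmorphM IH to_biv_poly_in.
by rewrite [to_biv 'X_j]mmapX mmap1U eq_sym (negPf ij).
Qed.

(** Primality of p does the work of Gauss's lemma.  If p and f are coprime as
    polynomials in X_j over k(X_i), a Bezout relation cleared of denominators
    gives r.  Otherwise a common factor d satisfies c p = e d and c' f = e' d
    with nonzero c, c' in k[X_i].  As d has positive degree in X_j, p divides d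
    rather than e, and so it divides c' f: either f, or c', which is then r. *)
Lemma elimination (p f : {mpoly k[2]}) :
  p != 0 ->
  (forall a b, mdvd p (a * b) -> mdvd p a \/ mdvd p b) ->
  mdvd p f \/
  exists2 r, r != 0 & exists a b, poly_in r = a * p + b * f.
Proof.
move=> p0 prime_p; pose P := to_biv p; pose G := to_biv f.
have P0 : P != 0.
  by apply: contraNneq p0 => P0; rewrite -[p]to_bivK -/P P0 rmorph0.
have [/Pdiv.Idomain.Bezout_coprimepP[[a b]]|] :=
  boolP (Pdiv.Idomain.coprimep P G).
  case/Pdiv.Idomain.eqpP => -[c1 c2] /= /andP[_ c20] E; right; exists c2 => //.
  exists (poly_in c1 * of_biv a), (poly_in c1 * of_biv b).
  have := congr1 of_biv E; rewrite -!mul_polyC mulr1 of_bivC => E'.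
  apply: etrans (esym E') _.
  by rewrite !(rmorphM, rmorphD) !to_bivK of_bivC; ring.
rewrite /Pdiv.Idomain.coprimep; set d := Pdiv.Idomain.gcdp P G => sd.
have /Pdiv.Idomain.dvdpP[[c e] /= c0 cP] := Pdiv.Idomain.dvdp_gcdl P G.
have /Pdiv.Idomain.dvdpP[[c' e'] /= c'0 cG] := Pdiv.Idomain.dvdp_gcdr P G.
have cp : poly_in c * p = of_biv e * of_biv d.
  by rewrite -rmorphM -cP -mul_polyC rmorphM of_bivC to_bivK.
have cf : poly_in c' * f = of_biv e' * of_biv d.
  by rewrite -rmorphM -cG -mul_polyC rmorphM of_bivC to_bivK.
have [|[g eg]|[g dg]] := prime_p (of_biv e) (of_biv d).
- by exists (poly_in c).
(* If p divided e, then d would divide the constant c. *)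
- have : poly_in c = g * of_biv d.
    by apply: (mulIf p0); rewrite cp eg; ring.
  move/(congr1 to_biv); rewrite rmorphM to_biv_poly_in of_bivK => cE.
  have : size (to_biv g * d) = 1%N by rewrite -cE size_polyC c0.
  move/eqP; rewrite size_poly_eq1 => gd1; case/negP: sd.
  by rewrite size_poly_eq1; move: gd1; apply/dvdp_eqp1/dvdp_mulIr.
have [|[g' c'g]|] := prime_p (poly_in c') f.
- by exists (of_biv e' * g); rewrite cf dg mulrA.
- by right; exists c' => //; exists g', 0; rewrite mul0r addr0.
- by left.
Qed.

End Elimination.

Lemma function_field_prime (k K : fieldType) (p : {mpoly k[2]})
    (iota : {rmorphism k -> K}) (x : 'I_2 -> K) :
  is_function_field p iota x ->
  forall a b : {mpoly k[2]}, mdvd p (a * b) -> mdvd p a \/ mdvd p b.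
Proof.
case=> kerP _ a b /kerP/eqP; rewrite rmorphM mulf_eq0.
by case/orP => /eqP/kerP; [left|right].
Qed.

(** * The pencil of a parametrization *)

Lemma meval_det_pencil (R : comNzRingType) n (A0 A1 A2 : 'M[R]_n)
    (v : 'I_2 -> R) :
  (\det (linear_pencil A0 A1 A2)).@[v]
  = \det (A0 + v ord0 *: A1 + v ord_max *: A2).
Proof.
rewrite -det_map_mx; congr (\det _); apply/matrixP => i j.
by rewrite !mxE /= !mevalD !mevalM !mevalXU !mevalC.
Qed.

Lemma msizeM_leq (n : nat) (R : idomainType) (f g : {mpoly R[n]}) :
  (msize (f * g)%R <= (msize f + msize g).-1)%N.
Proof.
have [->|f0] := eqVneq f 0; first by rewrite mul0r msize0.
have [->|g0] := eqVneq g 0; first by rewrite mulr0 msize0.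
by rewrite msizeM.
Qed.

Lemma msize_det_pencil (R : idomainType) n (A0 A1 A2 : 'M[R]_n) :
  (msize (\det (linear_pencil A0 A1 A2)) <= n.+1)%N.
Proof.
have entry i j : (msize (linear_pencil A0 A1 A2 i j) <= 2)%N.
  have sC (c : R) : (msize (c%:MP : {mpoly R[2]}) <= 1)%N.
    by rewrite msizeC leq_b1.
  have sXC l (c : R) : (msize ('X_l * c%:MP : {mpoly R[2]})%R <= 2)%N.
    apply: leq_trans (msizeM_leq _ _) _.
    by rewrite msizeX mdeg1; have := sC c; lia.
  rewrite !mxE; apply: leq_trans (msizeD_le _ _) _; rewrite geq_max sXC andbT.
  by apply: leq_trans (msizeD_le _ _) _; rewrite geq_max sXC andbT leqW.
have prod_le (t : 'I_n -> 'I_n) (r : seq 'I_n) :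
    (msize (\prod_(i <- r) linear_pencil A0 A1 A2 i (t i))%R <= (size r).+1)%N.
  elim: r => [|i r IH]; first by rewrite big_nil msize1.
  rewrite big_cons; apply: leq_trans (msizeM_leq _ _) _.
  by have := leq_add (entry i (t i)) IH; case: (_ + _)%N.
rewrite /determinant; apply: leq_trans (msize_sum _ _ _) _.
apply/bigmax_leqP => s _; rewrite mulr_sign.
have := prod_le _ (index_enum _).
by rewrite /index_enum -enumT size_enum_ord; case: ifP => _ //; rewrite msizeN.
Qed.

Lemma size_sub_scale (R : nzRingType) n (f g : {poly R}) (c : R) :
  (size f <= n)%N -> (size g <= n)%N -> (size (f - c *: g)%R <= n)%N.
Proof.
move=> sf sg; rewrite (leq_trans (size_polyD _ _)) // size_polyN geq_max sf.
exact: leq_trans (size_scale_leq _ _) sg.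
Qed.

Lemma exists_avoid (F : numFieldType) (a b : F) :
  (a != 0) || (b != 0) -> exists s, a - s * b != 0.
Proof.
have [->|b0 _] := eqVneq b 0.
  by rewrite orbF => a0; exists 0; rewrite mulr0 subr0.
exists ((a - 1) / b); rewrite divfK // subKr; exact: oner_neq0.
Qed.

(** It suffices to find a point (s, t) where the value of the pencil is
    invertible.  First s is chosen so that a = q1 - s q0 is nonzero, and of
    degree n if q0 or q1 is; then all but finitely many t make q2 - t q0 coprime
    to a. *)
Lemma det_bezout_pencil_neq0 (F : numFieldType) n (q0 q1 q2 : {poly F}) :
  q0 != 0 ->
  (forall d, d %| q0 -> d %| q1 -> d %| q2 -> size d = 1%N) ->
  (size q0 <= n.+1)%N -> (size q1 <= n.+1)%N -> (size q2 <= n.+1)%N ->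
  [|| q0`_n != 0, q1`_n != 0 | q2`_n != 0] ->
  \det (linear_pencil (bezoutian n q1 q2) (bezoutian n q2 q0)
          (bezoutian n q0 q1)) != 0.
Proof.
move=> q00 cop s0 s1 s2 top.
have [s [a0 a_top]] : exists s, q1 - s *: q0 != 0 /\
    ((q1 - s *: q0)`_n != 0 \/ (q0`_n = 0 /\ q2`_n != 0)).
  have [t01|] := boolP ((q1`_n != 0) || (q0`_n != 0)).
    have [s sE] := exists_avoid t01; exists s.
    suff an : (q1 - s *: q0)`_n != 0.
      by split; [apply: contraNneq an => ->; rewrite coef0 | left].
    by rewrite coefB coefZ.
  rewrite negb_or !negbK => /andP[/eqP q1n /eqP q0n].
  have [s sE] : exists s, q1`_(size q0).-1 - s * lead_coef q0 != 0.
    by apply: exists_avoid; rewrite lead_coef_eq0 q00 orbT.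
  exists s; split; last first.
    by right; split => //; move: top; rewrite q1n q0n eqxx.
  apply: contraNneq sE => a0; rewrite lead_coefE -coefZ -coefB a0.
  by rewrite coef0.
have size_top (f : {poly F}) : (size f <= n.+1)%N -> f`_n != 0 -> size f = n.+1.
  move=> sf fn; apply/eqP; rewrite eqn_leq sf ltnNge.
  by apply: contra fn => /(nth_default 0) ->.
have [t cop_t] : exists t, coprimep (q1 - s *: q0) (q2 - t *: q0).
  apply: exists_coprime_combination => // d da d2 d0; apply: cop => //.
  by rewrite -[q1](subrK (s *: q0)) dvdp_add // -mul_polyC dvdp_mull.
pose v (l : 'I_2) := if l == ord0 then s else t.
suff : (\det (linear_pencil (bezoutian n q1 q2) (bezoutian n q2 q0)
          (bezoutian n q0 q1))).@[v] != 0.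
  by apply: contraNneq => ->; rewrite meval0.
rewrite meval_det_pencil /v /= bezoutian_pencil.
case: a_top => [an|[q0n q2n]].
  by apply: det_bezoutian_neq0 => //; [apply: size_top => //|];
    exact: size_sub_scale.
(* If only q2 has degree n, the two arguments exchange their roles. *)
have -> : bezoutian n (q1 - s *: q0) (q2 - t *: q0)
    = -1 *: bezoutian n (q2 - t *: q0) (q1 - s *: q0).
  apply/matrixP => k l; rewrite [RHS]mxE !bezoutianE -coefZ.
  apply: (congr1 (fun f : {poly F} => f`_l)).
  by rewrite /bezout_row scaleN1r opprB.
rewrite detZ mulf_neq0 ?expf_neq0 ?oppr_eq0 ?oner_neq0 //.
apply: det_bezoutian_neq0; [|exact: size_sub_scale|by rewrite coprimep_sym].
by apply: size_top; rewrite ?size_sub_scale // coefB coefZ q0n mulr0 subr0.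
Qed.

Lemma vanishing_on_parametrization (R : realType) (p f : {mpoly R[2]}) m
    (q0 q1 q2 : {poly R}) :
  p != 0 ->
  (forall a b, mdvd p (a * b) -> mdvd p a \/ mdvd p b) ->
  is_rational_parametrization p m q0 q1 q2 ->
  (forall u, q0.[u] != 0 -> f.@[param_point q0 q1 q2 u 0] = 0) ->
  mdvd p f.
Proof.
move=> p0 prime_p [_ _ _ _ q00 nonconst on_p _] on_f.
pose q (i : 'I_2) := if i == ord0 then q1 else q2.
have constant i j : i != j -> ~ mdvd p f -> exists c, q i = c *: q0.
  move=> ij f_p; have [//|[r r0 [a [b rE]]]] := elimination ij f p0 prime_p.
  apply: (algebraic_ratio_constant q00 q00 r0) => u q0u _.
  have := meval_poly_in i (param_point q0 q1 q2 u 0) r.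
  by rewrite rE mevalD !mevalM (on_p u q0u) on_f // !mulr0 addr0 mxE => <-.
apply: contrapT => f_p; apply: nonconst.
have [c1 q1E] := constant ord0 ord_max isT f_p.
have [c2 q2E] := constant ord_max ord0 isT f_p.
exists (\row_(i < 2) if i == ord0 then c1 else c2) => u q0u.
apply/rowP => i; rewrite !mxE; have := q1E; have := q2E; rewrite /q /= => -> ->.
by case: ifP; rewrite hornerZ mulfK.
Qed.

Theorem lemma2 (R : realType) (m : nat) (p : {mpoly R[2]}) (q0 q1 q2 : {poly R}) :
  (1 <= m)%N ->
  irreducible_elt p ->
  msize p = m.+1 ->
  curve_genus p 0 ->
  is_rational_parametrization p m q0 q1 q2 ->
  let F := linear_pencil (bezoutian m q1 q2) (bezoutian m q2 q0)
             (bezoutian m q0 q1) in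
  is_symmetric_linear_pencil F /\
  exists c : R, c != 0 /\ \det F = c *: p.
Proof.
move=> m_gt0 _ size_p [K [iota [x [funK _]]]] param F; split.
  by do 3!eexists; split; last reflexivity; exact: bezoutian_sym.
have p0 : p != 0 by rewrite -msize_poly_eq0 size_p.
have prime_p := function_field_prime funK.
have [s0 s1 s2 cop q00 nonconst _ _] := param.
(* The true degree of the parametrization; that it equals m comes out at the
   end, from the degrees of det F and p. *)
pose n := (maxn (size q0) (maxn (size q1) (size q2))).-1.
have size_n : (maxn (size q0) (maxn (size q1) (size q2)) = n.+1)%N.
  by move: q00; rewrite -size_poly_gt0 /n; lia.
have [t0 t1 t2] : [/\ size q0 <= n.+1, size q1 <= n.+1 & size q2 <= n.+1]%N.
  by split; lia.
have n_gt0 : (0 < n)%N.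
  (* Constant q's would give a constant parametrization; u = 0 is arbitrary. *)
  rewrite lt0n; apply/eqP => n0; apply: nonconst.
  exists (param_point q0 q1 q2 0) => u _; apply/rowP => i; rewrite !mxE.
  have horner_const (f : {poly R}) : (size f <= n.+1)%N -> f.[u] = f.[0].
    by rewrite n0 => /size1_polyC ->; rewrite !hornerC.
  have [e0 e1 e2] := And3 (horner_const _ t0) (horner_const _ t1)
    (horner_const _ t2).
  by case: ifP => _; rewrite ?e0 ?e1 ?e2.
have top : [|| q0`_n != 0, q1`_n != 0 | q2`_n != 0].
  have lead (f : {poly R}) : size f = n.+1 -> f`_n != 0.
    move=> sf; have : lead_coef f != 0.
      by rewrite lead_coef_eq0 -size_poly_eq0 sf.
    by rewrite lead_coefE sf.
  have [/lead ->|[/lead ->|/lead ->]] :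
    size q0 = n.+1 \/ size q1 = n.+1 \/ size q2 = n.+1 by lia.
  - by [].
  - by rewrite orbT.
  - by rewrite !orbT.
have D0 := det_bezout_pencil_neq0 q00 cop t0 t1 t2 top.
have sD := msize_det_pencil (bezoutian n q1 q2) (bezoutian n q2 q0)
             (bezoutian n q0 q1).
set D := \det _ in D0 sD.
have [g DE] : mdvd p D.
  apply: (vanishing_on_parametrization p0 prime_p param) => u q0u.
  rewrite meval_det_pencil !mxE /= bezoutian_pencil.
  apply: (@det_bezoutian_common_root _ _ _ _ u) => //.
  - exact: size_sub_scale.
  - exact: size_sub_scale.
  - by rewrite rootE !hornerE divfK // subrr.
  - by rewrite rootE !hornerE divfK // subrr.
have g0 : g != 0 by apply: contraNneq D0 => g0; rewrite DE g0 mul0r.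
have sg : (0 < msize g)%N by rewrite lt0n msize_poly_eq0.
have deg_gp : (msize g + m <= n.+1)%N.
  by move: sD; rewrite DE msizeM // size_p addnS.
have mn : (m <= n)%N.
  by rewrite -ltnS (leq_trans _ deg_gp) // -add1n leq_add2r.
have nm : n = m by lia.
have sg1 : (msize g <= 1)%N by move: deg_gp; rewrite nm -[m.+1]add1n leq_add2r.
have gC := msize1_polyC sg1; exists g@_0; split.
  by apply: contraNneq g0 => c0; rewrite gC c0 mpolyC0.
by rewrite /F -nm -/D DE gC mul_mpolyC mcoeffC eqxx mulr1.
Qed.
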